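(* The homomorphism order $(\mathsf{DiCycles},\leq)$ on finite disjoint unions of directed cycles is universal.
   Context: $\overrightarrow{C}_k$ is the directed cycle on $k$ vertices with all edges oriented in the same direction. $\mathsf{DiCycles}$ is the class of directed graphs that are disjoint unions of finitely many directed cycles $\overrightarrow{C}_k$, $k\geq 3$. For directed graphs, $G\leq H$ means there is a homomorphism $G\to H$, i.e. a map $f:V_G\to V_H$ with $(f(u),f(v))\in E_H$ for every $(u,v)\in E_G$. This quasi-order is regarded as a partial order by identifying homomorphically equivalent graphs ($G\leq H\leq G$). A countable partial order is universal if every countable partial order $(P,\leq_P)$ embeds into it, i.e. there is a map $E$ with $a\leq_P b\iff E(a)\leq E(b)$ for all $a,b\in P$. *)

(* Defs.v *)
From mathcomp Require Import all_boot.
From Corelib Require Relation_Definitions.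

Set Implicit Arguments.
Unset Strict Implicit.
Unset Printing Implicit Defensive.

Record digraph := Digraph { vertex : finType; edge : rel vertex }.

Definition is_hom (G H : digraph) (f : vertex G -> vertex H) : Prop :=
  {homo f : u v / edge u v >-> edge u v}.

Definition hom_le (G H : digraph) : Prop :=
  exists f : vertex G -> vertex H, is_hom f.

Definition isomorphic (G H : digraph) : Prop :=
  exists f : vertex G -> vertex H,
    bijective f /\ {mono f : u v / edge u v >-> edge u v}.

(* [ordS i] is the successor of [i] modulo [k]. *)
Definition dicycle (k : nat) : digraph :=
  @Digraph 'I_k (fun i j => j == ordS i).

(* [tagged_as u v] is the vertex of [v] cast to the component of [u]; the cast
   is faithful since it is only used when both components agree. *)
Definition disjoint_union (I : finType) (G : I -> digraph) : digraph :=
  @Digraph {i : I & vertex (G i)}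
    (fun u v => (tag u == tag v) && edge (tagged u) (tagged_as u v)).

(* The empty union, n = 0, is allowed. *)
Definition is_DiCycles (G : digraph) : Prop :=
  exists (n : nat) (k : 'I_n -> nat),
    (forall i, 3 <= k i) /\
    isomorphic G (disjoint_union (fun i => dicycle (k i))).

Definition DiCycles := {G : digraph | is_DiCycles G}.

Definition DiCycles_le (G H : DiCycles) : Prop := hom_le (sval G) (sval H).

(* Classes are plain predicates, and countability is spelled out below, because
   MathComp's [set] and [countable] cannot be applied to a type of digraphs
   over arbitrary finTypes without a universe inconsistency. *)
Definition le_class (T : Type) (le : T -> T -> Prop) (x : T) : T -> Prop :=
  fun y => le x y /\ le y x.

(* The quotient of a quasi-order by the equivalence x <= y <= x, realized as
   the type of its equivalence classes. *)
Definition quotient (T : Type) (le : T -> T -> Prop) :=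
  {C : T -> Prop | exists x, C = le_class le x}.

Definition quotient_le (T : Type) (le : T -> T -> Prop)
    (C D : quotient le) : Prop :=
  exists x y, [/\ sval C x, sval D y & le x y].

Arguments quotient_le {T} le C D.

Definition countable_order (T : Type) (le : T -> T -> Prop) : Prop :=
  Relation_Definitions.order T le /\ exists f : T -> nat, injective f.

Definition universal (T : Type) (le : T -> T -> Prop) : Prop :=
  countable_order le /\
  forall (P : Type) (leP : P -> P -> Prop), countable_order leP ->
    exists E : P -> T, forall a b, leP a b <-> le (E a) (E b).

(* Main.v *)
(** There is a homomorphism from the directed cycle of length [k] to the one of
    length [l] iff [l] divides [k], so a union of cycles of lengths [s] maps to
    one of lengths [t] iff every element of [s] is a multiple of some element
    of [t].  To embed a preorder [r] on the natural numbers, let [n] be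
    represented by the product [upper_prod n] of the primes [p_i], [i <= n],
    [r n i]; then [upper_prod n] divides [upper_prod m] iff [n <= m] and
    [r m n].  Send [n] to the set of all [upper_prod m] with [m <= n] and
    [r m n].  If [r n n'] and [upper_prod m] is in the image of [n],
    then [upper_prod m] is also in the image of [n'] when [m <= n'], and it is a
    multiple of [upper_prod n'] otherwise; conversely, a divisor [upper_prod m] of
    [upper_prod n] with [r m n'] gives [r n m], hence [r n n']. *)

From mathcomp Require Import all_boot.
From Stdlib Require Import ClassicalEpsilon FunctionalExtensionality.
From Stdlib Require Import PropExtensionality ProofIrrelevance.
Require Import Defs.

Set Implicit Arguments.
Unset Strict Implicit.
Unset Printing Implicit Defensive.

(** * The partial order on equivalence classes and its countability *)

Section Quotient.

Variables (T : Type) (le : T -> T -> Prop).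
Hypotheses (le_refl : forall x, le x x)
           (le_trans : forall x y z, le x y -> le y z -> le x z).

Definition quotient_class (x : T) : quotient le :=
  exist _ (le_class le x) (ex_intro _ x erefl).

Lemma quotient_le_class x y :
  quotient_le le (quotient_class x) (quotient_class y) <-> le x y.
Proof.
split=> [[u [v [[xu ux] [yv vy] uv]]]|xy].
  exact: le_trans xu (le_trans uv vy).
by exists x, y.
Qed.

Lemma quotient_classP (C : quotient le) : exists x, C = quotient_class x.
Proof.
case: C => C [x Cx]; exists x.
exact: subset_eq_compat.
Qed.

Lemma quotient_class_eq x y :
  le x y -> le y x -> quotient_class x = quotient_class y.
Proof.
move=> xy yx; apply: subset_eq_compat.
apply: functional_extensionality => z; apply: propositional_extensionality.
by split=> -[h1 h2]; split; apply: le_trans; eassumption.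
Qed.

Lemma quotient_le_order :
  Relation_Definitions.order (quotient le) (quotient_le le).
Proof.
split.
- by move=> C; have [x ->] := quotient_classP C; apply/quotient_le_class.
- move=> C D E; have [x ->] := quotient_classP C.
  have [y ->] := quotient_classP D; have [z ->] := quotient_classP E.
  rewrite !quotient_le_class; exact: le_trans.
- move=> C D; have [x ->] := quotient_classP C.
  have [y ->] := quotient_classP D.
  rewrite !quotient_le_class; exact: quotient_class_eq.
Qed.

(** Elements sharing a code are equivalent, so the code of a chosen representative determines the
    class. *)
Lemma quotient_countable (K : countType) (code : T -> K) :
  (forall x y, code x = code y -> le x y) ->
  exists f : quotient le -> nat, injective f.
Proof.
move=> code_le.
pose rep C := sval (constructive_indefinite_description _ (quotient_classP C)).
have repE C : C = quotient_class (rep C).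
  by rewrite /rep; case: constructive_indefinite_description.
exists (fun C => pickle (code (rep C))) => C D /(pcan_inj pickleK) eqCD.
by rewrite (repE C) (repE D); apply: quotient_class_eq; apply: code_le.
Qed.

End Quotient.

(** * Homomorphisms between unions of cycles *)

Definition cycle_union n (k : 'I_n -> nat) : digraph :=
  disjoint_union (fun i => dicycle (k i)).

Section CycleUnion.

Variables (n : nat) (k : 'I_n -> nat).

Definition cycle_succ (u : vertex (cycle_union k)) : vertex (cycle_union k) :=
  Tagged (fun i => vertex (dicycle (k i))) (ordS (tagged u)).

Lemma edge_cycle_union u v :
  @edge (cycle_union k) u v = (v == cycle_succ u).
Proof.
case: u v => [i x] [j y]; rewrite /= -tag_eqE /tag_eq /= eq_sym.
case: (eqVneq j i) => //= ji; move: y; rewrite ji => y.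
by rewrite !tagged_asE.
Qed.

Lemma tag_iter_succ m u : tag (iter m cycle_succ u) = tag u.
Proof. by elim: m => //= m ->. Qed.

Lemma tagged_iter_succ m u :
  val (tagged (iter m cycle_succ u)) = (val (tagged u) + m) %% k (tag u).
Proof.
elim: m => [|m IHm] /=; first by rewrite addn0 modn_small ?ltn_ord.
by rewrite IHm tag_iter_succ -addn1 modnDml addn1 addnS.
Qed.

Lemma cycle_union_eqP (u v : vertex (cycle_union k)) :
  tag u = tag v -> val (tagged u) = val (tagged v) -> u = v.
Proof.
by case: u v => [i x] [j y] /= ij; move: y; rewrite -ij => y /val_inj ->.
Qed.

Lemma iter_succ_id m u : (iter m cycle_succ u = u) <-> k (tag u) %| m.
Proof.
split=> [um|/dvdnP[q ->]].
  have := tagged_iter_succ m u; rewrite um => um'.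
  have /eqP : val (tagged u) + 0 = val (tagged u) + m %[mod k (tag u)].
    by rewrite -um' addn0 modn_small ?ltn_ord.
  by rewrite eqn_modDl mod0n eq_sym.
apply: cycle_union_eqP; first exact: tag_iter_succ.
by rewrite tagged_iter_succ addnC modnMDl modn_small ?ltn_ord.
Qed.

End CycleUnion.

Lemma hom_cycle_union n m (k : 'I_n -> nat) (l : 'I_m -> nat) :
  (forall i, 0 < k i) ->
  hom_le (cycle_union k) (cycle_union l) <-> forall i, exists j, l j %| k i.
Proof.
move=> k_gt0; split=> [[f f_hom] i | dvd_lk].
  (* Every vertex has a single out-neighbour, so [f] commutes with the successor. *)
  have fS u : f (cycle_succ u) = cycle_succ (f u).
    apply/eqP; rewrite -edge_cycle_union; apply: f_hom.
    by rewrite edge_cycle_union.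
  pose u : vertex (cycle_union k) :=
    Tagged (fun i => vertex (dicycle (k i))) (Ordinal (k_gt0 i)).
  (* The closed walk of [k i] steps from [u] maps to a closed walk from [f u], so the cycle through
     [f u] has length dividing [k i]. *)
  exists (tag (f u)); apply/iter_succ_id.
  have <- : f (iter (k i) (@cycle_succ _ k) u) =
            iter (k i) (@cycle_succ _ l) (f u).
    by elim: (k i) => //= p <-.
  by congr f; apply/iter_succ_id.
have dvd_lk' i : {j | l j %| k i}.
  by apply: sigW; have [j] := dvd_lk i; exists j.
pose g i := sval (dvd_lk' i); have gP i : l (g i) %| k i := svalP (dvd_lk' i).
have l_gt0 i : 0 < l (g i) by apply: dvdn_gt0 (gP i).
(* Positions are reduced modulo the target length; since it divides [k i], this respects the
   wrap-around. *)
pose f (u : vertex (cycle_union k)) : vertex (cycle_union l) :=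
  Tagged (fun j => vertex (dicycle (l j)))
    (Ordinal (ltn_pmod (val (tagged u)) (l_gt0 (tag u)))).
exists f => u v; rewrite !edge_cycle_union => /eqP ->; apply/eqP.
apply: cycle_union_eqP => //=.
by rewrite modn_dvdm // -[in RHS]addn1 modnDml addn1.
Qed.

Lemma isomorphic_hom (G H : digraph) :
  isomorphic G H -> hom_le G H /\ hom_le H G.
Proof.
case=> f [[g fK gK] f_mono]; split; first by exists f => u v; rewrite f_mono.
by exists g => u v; rewrite -f_mono !gK.
Qed.

Lemma hom_le_trans G H K : hom_le G H -> hom_le H K -> hom_le G K.
Proof.
case=> f f_hom [g g_hom]; exists (g \o f) => u v uv.
exact/g_hom/f_hom.
Qed.

Lemma DiCycles_le_refl G : DiCycles_le G G.
Proof. by exists id. Qed.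

Lemma DiCycles_le_trans G H K :
  DiCycles_le G H -> DiCycles_le H K -> DiCycles_le G K.
Proof. exact: hom_le_trans. Qed.

Definition code_union (c : {n : nat & {ffun 'I_n -> nat}}) : digraph :=
  let: existT _ k := c in cycle_union k.

(** Finite functions make the codes a countable type; the default for [epsilon] is the empty
    union. *)
Definition DiCycles_code (G : DiCycles) : {n : nat & {ffun 'I_n -> nat}} :=
  epsilon (inhabits (existT (fun n => {ffun 'I_n -> nat}) 0 [ffun => 0]))
    (fun c => isomorphic (sval G) (code_union c)).

Lemma DiCycles_codeP G : isomorphic (sval G) (code_union (DiCycles_code G)).
Proof.
apply: (epsilon_spec _ (fun c => isomorphic (sval G) (code_union c))).
case: G => G [n [k [_ Gk]]] /=.
exists (existT _ n (finfun k)) => /=.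
suff -> : finfun k = k :> (_ -> _) by [].
by apply: functional_extensionality => i; rewrite ffunE.
Qed.

Lemma DiCycles_code_le G H :
  DiCycles_code G = DiCycles_code H -> DiCycles_le G H.
Proof.
move=> eqGH; have [+ _] := isomorphic_hom (DiCycles_codeP G).
have [_ +] := isomorphic_hom (DiCycles_codeP H).
rewrite -eqGH => h1 h2; exact: hom_le_trans h2 h1.
Qed.

(** * Encoding a preorder on the natural numbers by divisibility *)

(** Omitting the prime 2 makes each value, hence each [upper_prod], a legal cycle length of at least
    3. *)
Fixpoint odd_prime (n : nat) : nat :=
  s2val (prime_above (if n is n'.+1 then odd_prime n' else 2)).

Lemma odd_prime_prime n : prime (odd_prime n).
Proof. by case: n => [|n] /=; case: prime_above. Qed.

Lemma odd_prime_mono : {mono odd_prime : m n / m < n}.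
Proof.
apply/leqW_mono/leq_mono/(homo_ltn ltn_trans) => n.
by rewrite [X in _ < X]/=; case: prime_above.
Qed.

Lemma odd_prime_gt2 n : 2 < odd_prime n.
Proof.
case: n => [|n]; first by rewrite /=; case: prime_above.
apply: leq_ltn_trans (prime_gt1 (odd_prime_prime 0)) _.
by rewrite odd_prime_mono.
Qed.

Lemma odd_prime_dvd_prod N (A : pred nat) i :
  (odd_prime i %| \prod_(j < N | A j) odd_prime j) = (i < N) && A i.
Proof.
rewrite Euclid_dvd_prod ?odd_prime_prime // big_orE.
apply/existsP/andP=> [[j /andP[Aj]] | [iN Ai]].
  rewrite dvdn_prime2 ?odd_prime_prime // => /eqP eq_ij.
  have -> : i = j.
    by case: (ltngtP i j) => //; rewrite -odd_prime_mono eq_ij ltnn.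
  by [].
by exists (Ordinal iN); rewrite /= Ai /=.
Qed.

Section Encoding.

Variable r : rel nat.
Hypotheses (r_refl : reflexive r) (r_trans : transitive r).

Definition upper_prod n := \prod_(i < n.+1 | r n i) odd_prime i.

Lemma upper_prod_gt2 n : 2 < upper_prod n.
Proof.
apply: leq_trans (odd_prime_gt2 n) (dvdn_leq _ _).
  by apply: prodn_gt0 => i; apply: prime_gt0 (odd_prime_prime i).
by rewrite odd_prime_dvd_prod ltnSn r_refl.
Qed.

Lemma dvdn_upper_prod n m : (upper_prod n %| upper_prod m) = (n <= m) && r m n.
Proof.
apply/idP/andP=> [nm | [nm rmn]].
  (* By reflexivity [odd_prime n] is a factor of [upper_prod n]; it thus divides [upper_prod m]. *)
  apply/andP; rewrite -ltnS -(odd_prime_dvd_prod m.+1 (r m)).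
  by apply: dvdn_trans nm; rewrite odd_prime_dvd_prod ltnSn r_refl.
rewrite /upper_prod.
(* With both products indexed by ['I_m.+1], transitivity makes the factors of the first a subset of
   those of the second. *)
rewrite (big_ord_widen_cond m.+1 (r n) odd_prime) //.
apply: (dvdn_trans _ (_ : \prod_(i < m.+1 | r m i) odd_prime i %| _)) => //.
rewrite [X in _ %| X](bigID (fun i : 'I_m.+1 => r n i && (i < n.+1))) /=.
apply: dvdn_mulr; rewrite (eq_bigl (fun i : 'I_m.+1 =>
  r m i && (r n i && (i < n.+1)))) // => i.
by case rni: (r n i); rewrite /= ?andbF // (r_trans rmn rni).
Qed.

Definition lower_lengths n := [seq upper_prod m | m <- iota 0 n.+1 & r m n].

Lemma lower_lengthsP n c :
  reflect (exists m, [/\ m <= n, r m n & c = upper_prod m])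
          (c \in lower_lengths n).
Proof.
apply: (iffP mapP) => [[m] | [m [mn rmn ->]]].
  by rewrite mem_filter mem_iota => /and3P[rmn _ mn] ->; exists m.
by exists m; rewrite // mem_filter rmn mem_iota.
Qed.

Lemma lower_lengths_gt2 n c : c \in lower_lengths n -> 2 < c.
Proof. by case/lower_lengthsP=> m [_ _ ->]; apply: upper_prod_gt2. Qed.

Lemma lower_lengths_dvd n n' :
  r n n' <-> (forall c, c \in lower_lengths n ->
                exists2 d, d \in lower_lengths n' & d %| c).
Proof.
split=> [rnn' c /lower_lengthsP[m [mn rmn ->]] | dvd_nn'].
  have rmn' := r_trans rmn rnn'; case: (leqP m n') => [mn' | n'm].
    by exists (upper_prod m) => //; apply/lower_lengthsP; exists m.
  exists (upper_prod n'); first by apply/lower_lengthsP; exists n'.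
  by rewrite dvdn_upper_prod (ltnW n'm).
have [|d /lower_lengthsP[m [_ rmn' ->]]] := dvd_nn' (upper_prod n).
  by apply/lower_lengthsP; exists n.
by rewrite dvdn_upper_prod => /andP[_ /r_trans]; apply.
Qed.

Definition lower_cycles_family n (i : 'I_(size (lower_lengths n))) : nat :=
  tnth (in_tuple (lower_lengths n)) i.

Lemma lower_cycles_DiCycles n :
  is_DiCycles (cycle_union (@lower_cycles_family n)).
Proof.
exists _, (@lower_cycles_family n); split=> [i|].
  exact/(@lower_lengths_gt2 n)/mem_tnth.
by exists id; split=> //; exists id.
Qed.

Definition lower_cycles n : DiCycles := exist _ _ (lower_cycles_DiCycles n).

Lemma lower_cycles_le n n' :
  DiCycles_le (lower_cycles n) (lower_cycles n') <-> r n n'.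
Proof.
rewrite lower_lengths_dvd /DiCycles_le /= hom_cycle_union; last first.
  by move=> i; apply: leq_trans (lower_lengths_gt2 (mem_tnth i (in_tuple _))).
split=> [dvd c /(@tnthP _ _ (in_tuple _))[i ->] | dvd i].
  by have [j] := dvd i; exists (lower_cycles_family j) => //; apply: mem_tnth.
have [_ /(@tnthP _ _ (in_tuple _))[j ->] dvd_ji] :=
  dvd _ (mem_tnth i (in_tuple _)).
by exists j.
Qed.

End Encoding.

(** * Transfer of a countable order to the natural numbers *)

Section UpsetPreorder.

Variables (P : Type) (leP : P -> P -> Prop) (f : P -> nat).

(* Comparing principal up-sets yields a preorder on all of [nat], including the
   numbers outside of the range of [f], for which [upset] is empty. *)
Definition upset n c := exists2 b, f b = n & leP b c.

Definition upset_rel : rel nat := fun m n =>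
  if excluded_middle_informative (forall c, upset n c -> upset m c)
  then true else false.

Lemma upset_relP m n :
  reflect (forall c, upset n c -> upset m c) (upset_rel m n).
Proof.
by rewrite /upset_rel; case: excluded_middle_informative => h; constructor.
Qed.

Lemma upset_rel_refl : reflexive upset_rel.
Proof. by move=> n; apply/upset_relP. Qed.

Lemma upset_rel_trans : transitive upset_rel.
Proof.
by move=> n m p /upset_relP mn /upset_relP np; apply/upset_relP => c /np /mn.
Qed.

(** Injectivity makes [upset (f a)] the principal up-set of [a], and [a] lies below [b] exactly when
    its up-set contains that of [b]. *)
Lemma upset_relE : Relation_Definitions.order P leP -> injective f ->
  forall a b, leP a b <-> upset_rel (f a) (f b).
Proof.
case=> le_refl le_trans _ f_inj a b; split=> [ab | /upset_relP ba].
  apply/upset_relP=> c [b' /f_inj -> bc]; exists a => //.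
  exact: le_trans ab bc.
by have [|a' /f_inj ->] := ba b; first by exists b; last apply: le_refl.
Qed.

End UpsetPreorder.

Theorem theorem5p3p6 : universal (quotient_le DiCycles_le).
Proof.
split.
  split; first exact: quotient_le_order DiCycles_le_refl DiCycles_le_trans.
  exact (quotient_countable DiCycles_le_trans DiCycles_code_le).
move=> P leP [leP_order [f f_inj]].
have r_refl := upset_rel_refl leP f.
have r_trans := @upset_rel_trans P leP f.
exists (fun a => quotient_class _ (lower_cycles r_refl (f a))) => a b.
rewrite (quotient_le_class DiCycles_le_refl DiCycles_le_trans).
by rewrite (lower_cycles_le r_refl r_trans); apply: upset_relE.
Qed.
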